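(* Let $F$ be a field of characteristic $0$, let $R\in F[X]$ be a polynomial of degree $d\ge0$, and let $H=x\partial_x$ and $G=R(x\partial_x)\partial_x$ be acting on $F[x]$. For $n=0,1,2,\dots$ put $$P_n^R(x)=e^Gx^n=\sum_{j\ge0}\frac{G^jx^n}{j!},$$ and let $L=\sigma(H)=x\partial_x+R(x\partial_x)\partial_x$ and $M=\sigma(x)$, where $\sigma=e^{\mathrm{ad}_G}$. Then: (i) The polynomials $P_n^R$ are eigenfunctions of the differential operator $L$ with eigenvalues $\lambda(n)=n$: $LP_n^R=nP_n^R$. (ii) They satisfy the recurrence relation $$xP_n^R(x)=P_{n+1}^R(x)+\sum_{j=1}^{d+1}\frac{(-1)^j\,[nR(n-1)T^{-1}]^{j-1}\,\Delta^jS(n)}{j!}\,P_n^R(x).$$ (iii) The operator $G$ is a lowering operator and $M$ is a raising operator: $$GP_n^R(x)=nR(n-1)P_{n-1}^R(x),\qquad MP_n^R(x)=P_{n+1}^R(x).$$ (iv) The Rodrigues-type formula $P_n^R(x)=M^n1$ holds.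
   Context: $\partial_x$ is differentiation on $F[x]$ and $x$ also denotes the operator of multiplication by $x$. The operator $G$ lowers degree by (at least) $1$, so the series defining $P_n^R$ is finite. $\mathrm{ad}_G(A)=GA-AG$ and $\sigma(A)=e^{\mathrm{ad}_G}(A)=\sum_{j\ge0}\mathrm{ad}_G^j(A)/j!$ for $A$ in the algebra generated by $x$, $x\partial_x$, $G$ (on which $\mathrm{ad}_G$ is locally nilpotent, so the sum is finite). $S(X):=R(X-1)X$ and $\Delta f(X)=f(X+1)-f(X)$. In (ii), the expression multiplying $P_n^R$ is an operator acting on functions of the index $n$: $T^{-1}$ acts by $T^{-1}f(n)=f(n-1)$, and functions of $n$ act by multiplication (operators composed right to left). Thus the $j$-th term of the sum equals $\frac{(-1)^j}{j!}\Bigl(\prod_{k=1}^{j-1}(n-k+1)R(n-k)\Bigr)(\Delta^jS)(n-j+1)\,P^R_{n-j+1}(x)$. Polynomials with negative index, which occur only with coefficient zero, are taken to be $0$. *)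

(* Defs.v *)
From mathcomp Require Import all_boot all_order all_algebra.
From mathcomp Require Import boolp classical_sets functions fsbigop.

Set Implicit Arguments.
Unset Strict Implicit.
Unset Printing Implicit Defensive.

Import GRing.Theory.
Local Open Scope ring_scope.

(* Operators on F[x] are plain functions {poly F} -> {poly F}, with the
   pointwise F-module structure on functions; the product of operators is
   composition \o. *)
Notation operator F := ({poly F} -> {poly F}).

Section Operators.
Variable F : fieldType.
Implicit Types (A G : operator F) (R p : {poly F}).

Definition opX : operator F := fun p => 'X * p.
Definition opD : operator F := fun p => p^`().
Definition opH : operator F := opX \o opD.

Definition op_eval R A : operator F :=
  fun p => \sum_(i < size R) R`_i *: iter i A p.

Definition opG R : operator F := op_eval R opH \o opD.

(* In op_exp and sigma the sum over all j : nat is the library's sum over the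
   finite set of indices of the nonzero terms; by convention it is 0 when
   infinitely many terms are nonzero, which does not happen for G = opG R,
   nor for A in the algebra generated by x, x d/dx and G. *)
Definition op_exp G : operator F :=
  fun p => \sum_(j \in [set: nat]) (j`!%:R^-1 : F) *: iter j G p.

Definition ad G A : operator F := (G \o A) - (A \o G).

Definition sigma G A : operator F :=
  \sum_(j \in [set: nat]) (j`!%:R^-1 : F) *: iter j (ad G) A.

Definition PR R (n : nat) : {poly F} := op_exp (opG R) 'X^n.

Definition PRz R (n : int) : {poly F} :=
  if n is Posz m then PR R m else 0.

Definition opL R : operator F := sigma (opG R) opH.
Definition opM R : operator F := sigma (opG R) opX.

Definition polyS R : {poly F} := (R \Po ('X - 1)) * 'X.
Definition Delta p : {poly F} := (p \Po ('X + 1)) - p.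

(* Operators on F[x]-valued functions of the index n, which ranges over int so
   that the inverse shift is everywhere defined. *)
Definition shiftV (f : int -> {poly F}) : int -> {poly F} :=
  fun n => f (n - 1).
Definition mulfun (c : int -> F) (f : int -> {poly F}) : int -> {poly F} :=
  fun n => c n *: f n.

Definition lowcoef R (n : int) : F := n%:~R * R.[(n - 1)%:~R].

Definition rec_term R (j : nat) : int -> {poly F} :=
  mulfun (fun=> (-1) ^+ j / j`!%:R)
    (iter j.-1 (mulfun (lowcoef R) \o shiftV)
       (mulfun (fun n => (iter j Delta (polyS R)).[n%:~R]) (PRz R))).

End Operators.

Arguments opX {F}.
Arguments opD {F}.
Arguments opH {F}.

(* Main.v *)
(** Everything follows from two intertwining identities for a locally nilpotent
    G and an operator A with ad_G^i(A) = 0 for large i: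
      e^G A = sigma(A) e^G,   A e^G = sum_i (-1)^i / i! e^G ad_G^i(A).
    On monomials, A = H, x, G in the first identity gives (i), the raising
    property in (iii) (hence (iv)) and the lowering property in (iii), since
    ad_G(H) = G and ad_G(G) = 0.  The second identity with A = x is (ii):
    G x^n = S(n) x^(n-1) implies
      ad_G^j(x) x^n = S(n) ... S(n-j+2) (Delta^j S)(n-j+1) x^(n-j+1),
    and Delta^j S = 0 for j > d + 1 because deg S = d + 1. *)

Require Import Defs.
From mathcomp Require Import all_boot all_order all_algebra.
From mathcomp Require Import boolp classical_sets functions fsbigop.
From mathcomp Require Import ring.

Set Implicit Arguments.
Unset Strict Implicit.
Unset Printing Implicit Defensive.

Import GRing.Theory.
Local Open Scope ring_scope.

(** * Binomial expansions and products of exponential series *)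

(* Abstracts the expansion of [(L + R)^m] for commuting [L] and [R], where [L]
   raises the index [i] and [R] raises [l]. *)
Lemma leibniz_expansion {V : nmodType} (h : nat -> nat -> nat -> V)
    (hS : forall m i l, h m.+1 i l = h m i.+1 l + h m i l.+1) m i l :
  h m i l = \sum_(k < m.+1) h 0 (i + k)%N (l + (m - k))%N *+ 'C(m, k).
Proof.
elim: m i l => [|m IH] i l; first by rewrite big_ord1 !addn0 bin0.
(* One end term of each sum matches an end term of the goal; the others pair up by Pascal's rule. *)
rewrite hS !IH [X in X + _ = _]big_ord_recr [X in _ + X = _]big_ord_recl.
rewrite [RHS]big_ord_recl [X in _ = _ + X]big_ord_recr /= /bump !bin0 !binn.
rewrite !add1n !subn0 !subnn !addn0 !addSnnS [LHS]addrC -!addrA.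
congr (_ + _); rewrite [LHS]addrA; congr (_ + _).
rewrite -big_split /=; apply: eq_bigr => k _.
by rewrite add1n binS mulrnDr subSS !addSnnS subnSK.
Qed.

(** Summation along antidiagonals: [f] is supported in an [N] by [K] rectangle, on which
    [i + l < N + K]. *)
Lemma exchange_big_triangle {V : nmodType} (f : nat -> nat -> V) N K :
    (forall i l, (N <= i)%N || (K <= l)%N -> f i l = 0) ->
  \sum_(m < N + K) \sum_(i < m.+1) f i (m - i)%N
    = \sum_(i < N) \sum_(l < K) f i l.
Proof.
move=> f0.
under eq_bigr => m _ do
  rewrite (big_ord_widen (N + K) (fun i => f i (m - i)%N) (ltn_ord m)).
rewrite (exchange_big_dep predT) //= big_split_ord /=.
rewrite [X in _ + X]big1 ?addr0 => [|i _]; last first.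
  by rewrite big1 // => m _; rewrite f0 // leq_addr.
apply: eq_bigr => i _.
(* For fixed [i] the indices [m] split into [m < i] (excluded), [m - i < K] (kept), and the rest,
   where [f] vanishes. *)
have -> : (N + K = i + (K + (N - i)))%N.
  by rewrite addnCA subnKC ?(ltnW (ltn_ord i)) // addnC.
rewrite big_split_ord /= big_pred0 ?add0r => [|m]; last first.
  by rewrite ltnS leqNgt ltn_ord.
rewrite (eq_bigl predT) => [|m]; last by rewrite ltnS leq_addr.
rewrite big_split_ord /= [X in _ + X]big1 ?addr0 => [|m _]; last first.
  by rewrite f0 // addKn leq_addr orbT.
by apply: eq_bigr => m _; rewrite addKn.
Qed.

(** This is [exp(L + R) = exp(L) exp(R)] for commuting [L] and [R]: in characteristic 0,
    ['C(m, i) / m! = 1 / (i! (m - i)!)]. *)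
Lemma exp_leibniz_expansion {F : fieldType} (charF : [pchar F] =i pred0)
    {V : lmodType F} (h : nat -> nat -> nat -> V) N K :
    (forall m i l, h m.+1 i l = h m i.+1 l + h m i l.+1) ->
    (forall i l, (N <= i)%N || (K <= l)%N -> h 0 i l = 0) ->
  \sum_(m < N + K) m`!%:R^-1 *: h m 0 0
    = \sum_(i < N) \sum_(l < K) (i`!%:R^-1 * l`!%:R^-1) *: h 0 i l.
Proof.
move=> hS h0.
have nat0 n : (0 < n)%N -> n%:R != 0 :> F.
  by move/pcharf0P: charF => ->; rewrite lt0n.
pose f i l := (i`!%:R^-1 * l`!%:R^-1 : F) *: h 0%N i l.
rewrite -[RHS](@exchange_big_triangle _ f) => [|i l il]; last first.
  by rewrite /f h0 ?scaler0.
apply: eq_bigr => m _; rewrite leibniz_expansion // scaler_sumr.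
apply: eq_bigr => i _; rewrite /f !add0n -scaler_nat scalerA; congr (_ *: _).
have im : (i <= m)%N by rewrite -ltnS.
by rewrite -(bin_fact im) !natrM; field; rewrite !nat0 ?fact_gt0 ?bin_gt0.
Qed.

(** * Linear operators on polynomials *)

Section LinearOperators.
Context {F : fieldType}.
Implicit Types (A B G : operator F) (p R : {poly F}).

Lemma operatorD A : linear A -> {morph A : p q / p + q}.
Proof. by move=> linA p q; rewrite -{1}[p]scale1r linA scale1r. Qed.

Lemma operator0 A : linear A -> A 0 = 0.
Proof.
by move=> linA; apply: (addrI (A 0)); rewrite -operatorD ?addr0.
Qed.

Lemma operatorZ A : linear A -> forall a, {morph A : p / a *: p}.
Proof.
by move=> linA a p; rewrite -{1}[a *: p]addr0 linA operator0 ?addr0.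
Qed.

Lemma operator_sum A : linear A -> forall n (f : 'I_n -> {poly F}),
  A (\sum_(i < n) f i) = \sum_(i < n) A (f i).
Proof.
by move=> linA n f; exact: (big_morph A (operatorD linA) (operator0 linA)).
Qed.

Lemma linear_comp A B : linear A -> linear B -> linear (A \o B).
Proof. by move=> linA linB a p q /=; rewrite linB linA. Qed.

Lemma linear_iter A i : linear A -> linear (iter i A).
Proof.
by move=> linA; elim: i => [|i IH] a p q //=; rewrite (IH a p q) linA.
Qed.

Lemma adE G A p : ad G A p = G (A p) - A (G p).
Proof. by []. Qed.

Lemma linear_ad G A : linear G -> linear A -> linear (ad G A).
Proof.
move=> linG linA a p q; rewrite /ad /= !fctE /= !linA !linG linA.
by rewrite scalerBr opprD addrACA.
Qed.

Lemma linear_iter_ad G A i : linear G -> linear A -> linear (iter i (ad G) A).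
Proof. by move=> linG linA; elim: i => //= i; apply: linear_ad. Qed.

Lemma linear_opX : linear (@opX F).
Proof. by move=> a p q; rewrite /opX mulrDr scalerAr. Qed.

Lemma linear_opD : linear (@opD F).
Proof. by move=> a p q; rewrite /opD linearP. Qed.

Lemma linear_opH : linear (@opH F).
Proof. exact: (linear_comp linear_opX linear_opD). Qed.

Lemma linear_op_eval R A : linear A -> linear (op_eval R A).
Proof.
move=> linA a p q; rewrite /op_eval scaler_sumr -big_split /=.
by apply: eq_bigr => i _; rewrite linear_iter // scalerDr !scalerA mulrC.
Qed.

Lemma linear_opG R : linear (opG R).
Proof. exact: (linear_comp (linear_op_eval _ linear_opH) linear_opD). Qed.

Lemma linear_poly_def A p :
  linear A -> A p = \sum_(i < size p) p`_i *: A 'X^i.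
Proof.
move=> linA; rewrite -{1}[p]coefK poly_def.
by rewrite operator_sum //; apply: eq_bigr => i _; rewrite operatorZ.
Qed.

Lemma eq_linear_monomials A B :
  linear A -> linear B -> (forall n, A 'X^n = B 'X^n) -> A = B.
Proof.
move=> linA linB AB; apply: funext => p.
by rewrite !linear_poly_def //; apply: eq_bigr => i _; rewrite AB.
Qed.

End LinearOperators.

(** * Exponentials of locally nilpotent operators *)

Lemma fsbig_truncate {V : nmodType} (f : nat -> V) K :
  (forall j, (K <= j)%N -> f j = 0) ->
  \sum_(j \in [set: nat]) f j = \sum_(j < K) f j.
Proof.
move=> f0; rewrite (@fsbigE _ _ _ _ _ (index_iota 0 K)) ?iota_uniq //.
  by rewrite big_mkcond big_mkord; apply: eq_bigr => j _; rewrite in_setT.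
move=> j /= _; rewrite mem_index_iota /= -leqNgt; apply: f0.
Qed.

(** The bound [K] may depend on [p]: already d/dx has no uniform bound in characteristic 0. *)
Definition locally_nilpotent {F : fieldType} (G : operator F) :=
  forall p, exists K, forall j, (K <= j)%N -> iter j G p = 0.

Section Exponential.
Context {F : fieldType}.
Variable G : operator F.
Hypotheses (charF : [pchar F] =i pred0) (linG : linear G)
  (nilG : locally_nilpotent G).
Implicit Types (A : operator F) (p : {poly F}).

Lemma op_exp_truncate p K : (forall j, (K <= j)%N -> iter j G p = 0) ->
  op_exp G p = \sum_(j < K) j`!%:R^-1 *: iter j G p.
Proof.
by move=> G0; apply: fsbig_truncate => j jK; rewrite G0 ?scaler0.
Qed.

Lemma sigmaE A N : (forall j, (N <= j)%N -> iter j (ad G) A = 0) ->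
  forall p, sigma G A p = \sum_(j < N) j`!%:R^-1 *: iter j (ad G) A p.
Proof.
move=> A0 p; rewrite /sigma (@fsbig_truncate _ _ N) ?fct_sumE // => j jN.
by rewrite A0 ?scaler0.
Qed.

Lemma linear_op_exp : linear (op_exp G).
Proof.
move=> a p q; have [K Kp] := nilG p; have [L Lq] := nilG q.
have Mp j : (maxn K L <= j)%N -> iter j G p = 0.
  by rewrite geq_max => /andP[/Kp].
have Mq j : (maxn K L <= j)%N -> iter j G q = 0.
  by rewrite geq_max => /andP[_ /Lq].
rewrite !(@op_exp_truncate _ (maxn K L)) // => [|j jM]; last first.
  by rewrite linear_iter // Mp // Mq // scaler0 addr0.
rewrite scaler_sumr -big_split /=; apply: eq_bigr => j _.
by rewrite linear_iter // scalerDr !scalerA mulrC.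
Qed.

Lemma op_exp_nilp K p :
  exists2 L, (K <= L)%N & forall j, (L <= j)%N -> iter j G p = 0.
Proof.
have [L Lp] := nilG p; exists (maxn K L); first exact: leq_maxl.
by move=> j; rewrite geq_max => /andP[_ /Lp].
Qed.

(** Since [G B = ad G B + B G], left multiplication by [G] is the sum of two commuting maps, [ad G]
    and right multiplication by [G], so its exponential factors. *)
Lemma op_exp_intertwine A N : linear A ->
    (forall i, (N <= i)%N -> iter i (ad G) A = 0) ->
  forall p, op_exp G (A p) = sigma G A (op_exp G p).
Proof.
move=> linA A0 p; rewrite (sigmaE A0).
have [K0 K0A] := nilG (A p).
(* Taking [K0 <= K] makes the cutoff [N + K] valid for [A p] too. *)
have [K K0K Kp] := op_exp_nilp K0 p.
pose h m i l := iter m G (iter i (ad G) A (iter l G p)).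
have hS m i l : h m.+1 i l = h m i.+1 l + h m i l.+1.
  rewrite /h iterSr -(operatorD (linear_iter m linG)).
  by rewrite iterS adE iterS subrK.
rewrite (@op_exp_truncate _ (N + K)) => [|j NKj]; last first.
  by apply: K0A; apply: leq_trans NKj; rewrite (leq_trans K0K) // leq_addl.
rewrite (exp_leibniz_expansion charF hS) => [|i l /orP[Ni|Kl]].
- apply: eq_bigr => i _; rewrite (op_exp_truncate Kp).
  have linAi := linear_iter_ad i linG linA.
  rewrite (operator_sum linAi) scaler_sumr; apply: eq_bigr => l _.
  by rewrite (operatorZ linAi) scalerA.
- by rewrite /h A0.
- by rewrite /h Kp // (operator0 (linear_iter_ad i linG linA)).
Qed.

(** Supplies one cutoff for all [iter i (ad G) A p] with [i < N] in the inverse identity. *)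
Lemma locally_nilpotent_seq (f : nat -> {poly F}) N :
  exists K, forall i j, (i < N)%N -> (K <= j)%N -> iter j G (f i) = 0.
Proof.
elim: N => [|N [K IH]]; first by exists 0%N.
have [L KL fN] := op_exp_nilp K (f N); exists L => i j iN Lj.
move: iN; rewrite ltnS leq_eqVlt => /predU1P[->|iN]; first exact: fN.
by apply: IH => //; apply: leq_trans Lj.
Qed.

(** Here [B G = G B - ad G B]: right multiplication by [G] is the sum of the commuting maps [- ad G]
    and left multiplication by [G]; the minus sign produces [(-1) ^+ i]. *)
Lemma op_exp_intertwine_inv A N : linear A ->
    (forall i, (N <= i)%N -> iter i (ad G) A = 0) ->
  forall p, A (op_exp G p) =
    \sum_(i < N) ((-1) ^+ i / i`!%:R) *: op_exp G (iter i (ad G) A p).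
Proof.
move=> linA A0 p.
have [K0 K0A] := locally_nilpotent_seq (fun i => iter i (ad G) A p) N.
have [K K0K Kp] := op_exp_nilp K0 p.
pose h m i l : {poly F} :=
  (-1) ^+ i *: iter l G (iter i (ad G) A (iter m G p)).
have hS m i l : h m.+1 i l = h m i.+1 l + h m i l.+1.
  rewrite /h iterS [iter l.+1 G _]iterSr iterS adE exprS mulN1r scaleNr.
  rewrite -scalerN -scalerDr; congr (_ *: _).
  rewrite -scaleN1r -(operatorZ (linear_iter l linG)) scaleN1r.
  by rewrite -(operatorD (linear_iter l linG)) opprB subrK.
rewrite (@op_exp_truncate _ (N + K)) => [|j NKj]; last first.
  by apply: Kp; rewrite (leq_trans _ NKj) ?leq_addl.
rewrite (operator_sum linA).
under eq_bigr do rewrite (operatorZ linA).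
have := @exp_leibniz_expansion _ charF _ h N K hS.
rewrite /h /=; under eq_bigr do rewrite expr0 scale1r.
move=> -> => [|i l /orP[Ni|Kl]].
- apply: eq_bigr => i _; rewrite (op_exp_truncate (K := K)) => [|j Kj].
    rewrite scaler_sumr; apply: eq_bigr => l _; rewrite !scalerA.
    by congr (_ *: _); ring.
  by apply: K0A => //; apply: leq_trans Kj.
- by rewrite A0 // (operator0 (linear_iter l linG)) scaler0.
(* [K0A] covers only [i < N]; beyond that [A0] applies. *)
- have [iN|Ni] := ltnP i N; first by rewrite K0A ?scaler0 // (leq_trans K0K).
  by rewrite A0 // (operator0 (linear_iter l linG)) scaler0.
Qed.

End Exponential.

(** * Action of the operators on monomials *)

Section Monomials.
Context {F : fieldType}.
Implicit Types (R p : {poly F}).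

Lemma horner_polyS R a : (polyS R).[a] = R.[a - 1] * a.
Proof. by rewrite /polyS hornerM horner_comp !hornerE. Qed.

Lemma horner_Delta p a : (Delta p).[a] = p.[a + 1] - p.[a].
Proof. by rewrite /Delta !hornerE horner_comp !hornerE. Qed.

Lemma opH_monomial n : opH 'X^n = n%:R *: 'X^n :> {poly F}.
Proof.
rewrite /opH /opX /opD /= derivXn; case: n => [|n].
  by rewrite mulr0n mulr0 scale0r.
by rewrite mulrnAr -exprS scaler_nat.
Qed.

Lemma op_evalH_monomial R n : op_eval R (@opH F) 'X^n = R.[n%:R] *: 'X^n.
Proof.
rewrite /op_eval horner_coef scaler_suml; apply: eq_bigr => i _.
rewrite -scalerA; congr (_ *: _); elim: (val i) => [|k IH] /=.
  by rewrite expr0 scale1r.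
by rewrite IH (operatorZ linear_opH) opH_monomial scalerA exprSr.
Qed.

(** At [n = 0] the exponent [n.-1] is 0 rather than -1, which is harmless because [S(0) = 0]. *)
Lemma opG_monomial R n :
  opG R 'X^n = (polyS R).[n%:R] *: 'X^(n.-1).
Proof.
rewrite /opG [LHS]/= [opD _]derivXn horner_polyS -scaler_nat.
rewrite (operatorZ (linear_op_eval R linear_opH)) op_evalH_monomial scalerA.
case: n => [|n]; first by rewrite mulr0 mul0r.
by rewrite mulrC -[n.+1%:R]natr1 addrK.
Qed.

Lemma polyS0 R : (polyS R).[0] = 0.
Proof. by rewrite horner_polyS mulr0. Qed.

Lemma iter_opG_monomial R n j : (n < j)%N -> iter j (opG R) 'X^n = 0.
Proof.
elim: j n => // j IH n nj; rewrite iterSr opG_monomial.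
rewrite (operatorZ (linear_iter j (linear_opG R))).
by case: n nj => [|n] nj; [rewrite polyS0 scale0r | rewrite IH ?scaler0].
Qed.

Lemma opG_locally_nilpotent R : locally_nilpotent (opG R).
Proof.
move=> p; exists (size p) => j pj.
rewrite (linear_poly_def p (linear_iter j (linear_opG R))) big1 // => i _.
by rewrite iter_opG_monomial ?scaler0 // (leq_trans (ltn_ord i)).
Qed.

(** [G] lowers the [H]-eigenvalue of [x^n] from [n] to [n - 1], so the commutator multiplies [G x^n]
    by [n - (n - 1) = 1]. *)
Lemma ad_opG_opH R : ad (opG R) opH = opG R.
Proof.
have linG := linear_opG R.
apply: eq_linear_monomials => // [|n].
  exact: (linear_ad linG linear_opH).
rewrite !adE opH_monomial (operatorZ linG) opG_monomial.
rewrite (operatorZ linear_opH) opH_monomial !scalerA -scalerBl.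
case: n => [|n] /=; first by rewrite polyS0 !(mulr0, mul0r) subr0.
by rewrite -[n.+1%:R]natr1; congr (_ *: _); ring.
Qed.

Lemma iter_ad_opG_opH R j : (2 <= j)%N -> iter j (ad (opG R)) opH = 0.
Proof.
have adGG : ad (opG R) (opG R) = 0 by rewrite /ad subrr.
have ad0 : ad (opG R) 0 = 0.
  by apply: funext => p; rewrite !adE (operator0 (linear_opG R)) subr0.
case: j => [|[|j]] // _; elim: j => [|j IH]; first by rewrite /= ad_opG_opH.
by rewrite iterS IH.
Qed.

(** * Finite differences and iterated commutators with [x] *)

(** Substituting [X + 1] keeps the degree and the leading coefficient, so the leading terms
    cancel. *)
Lemma size_Delta_leq p k : (size p <= k.+1)%N -> (size (Delta p) <= k)%N.
Proof.
move=> pk.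
have sX1 : size ('X + 1 : {poly F}) = 2 by rewrite -polyC1 size_XaddC.
have [p1|p1] := leqP (size p) 1.
  by rewrite (size1_polyC p1) /Delta comp_polyC subrr size_poly0.
apply/leq_sizeP => i; rewrite leq_eqVlt => /predU1P[<-|ki].
  have [pk1|kp] := leqP (size p) k.
    by rewrite coefB !nth_default ?subr0 ?size_comp_poly2.
  have spk : size p = k.+1 by apply/eqP; rewrite eqn_leq pk.
  rewrite coefB; have -> : p`_k = lead_coef p by rewrite lead_coefE spk.
  have -> : (p \Po ('X + 1))`_k = lead_coef (p \Po ('X + 1)).
    by rewrite lead_coefE size_comp_poly2 // spk.
  rewrite lead_coef_comp ?sX1 // -polyC1 lead_coefXaddC expr1n mulr1.
  exact: subrr.
by rewrite coefB !nth_default ?subr0 ?size_comp_poly2 // (leq_trans pk).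
Qed.

Lemma iter_Delta_eq0 p j : (size p <= j)%N -> iter j (@Delta F) p = 0.
Proof.
elim: j p => [|j IH] p pj; first by apply/eqP; rewrite -size_poly_leq0.
by rewrite iterSr IH // size_Delta_leq.
Qed.

Lemma size_polyS_leq R : (size (polyS R) <= (size R).+1)%N.
Proof.
rewrite /polyS (leq_trans (size_polyMleq _ _)) // size_polyX addn2 /=.
by rewrite size_comp_poly2 // -polyC1 size_XsubC.
Qed.

(** For [n < j] the argument [n - j] is truncated to 0, but both products contain the factor
    [S(0) = 0] at [k = n]. *)
Lemma prod_polyS_recr R n j :
  (\prod_(k < j) (polyS R).[n%:R - k%:R]) * (polyS R).[(n - j)%:R]
    = \prod_(k < j.+1) (polyS R).[n%:R - k%:R].
Proof.
rewrite big_ord_recr /=; have [jn|nj] := leqP j n; first by rewrite natrB.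
by rewrite (bigD1 (Ordinal nj)) //= subrr polyS0 !mul0r.
Qed.

(* For [n < j] the factor [k = n] of the product vanishes, so the truncated
   exponent [n - j] is harmless. *)
Lemma iter_ad_opG_opX R j n :
  iter j.+1 (ad (opG R)) opX 'X^n =
    ((\prod_(k < j) (polyS R).[n%:R - k%:R])
       * (iter j.+1 (@Delta F) (polyS R)).[n%:R - j%:R]) *: 'X^(n - j).
Proof.
have linG := linear_opG R.
elim: j n => [|j IH] n.
  rewrite /= big_ord0 mul1r subr0 subn0 !adE opG_monomial.
  rewrite /opX -exprS opG_monomial /= horner_Delta natr1.
  case: n => [|n] /=; first by rewrite polyS0 !scale0r !subr0 mulr0 subr0.
  by rewrite -scalerAr -exprS -scalerBl.
rewrite iterS adE IH opG_monomial (operatorZ linG) opG_monomial.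
rewrite (operatorZ (linear_iter_ad j.+1 linG linear_opX)) IH !scalerA.
(* Both terms carry the product of [S(n - k)] over [k <= j]; what remains,
   [f(n - j) - f(n - j - 1)], is [Delta f] at [n - j - 1]. *)
set f := iter j.+1 _ _; rewrite mulrAC prod_polyS_recr iterS horner_Delta.
case: n => [|n].
  by rewrite big_ord_recl subrr polyS0 !mul0r !scale0r subrr.
rewrite -subnS subSS -scalerBl; congr (_ *: _).
have -> : n.+1%:R - j.+1%:R = n%:R - j%:R :> F.
  by rewrite -!natr1; ring.
have -> : n.+1%:R - j%:R = n%:R - j%:R + 1 :> F.
  by rewrite -natr1; ring.
rewrite mulrBr; congr (_ - _); rewrite big_ord_recl subr0 -mulrA.
congr (_ * (_ * _)); apply: eq_bigr => k _.
by rewrite /= /bump add1n -!natr1; congr (_.[_]); ring.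
Qed.

Lemma iter_ad_opG_opX_eq0 R j :
  (size R <= j)%N -> iter j.+1 (ad (opG R)) opX = 0.
Proof.
move=> Rj; apply: eq_linear_monomials => [||n].
- exact: (linear_iter_ad _ (linear_opG R) linear_opX).
- by move=> a p q; rewrite scaler0 addr0.
rewrite iter_ad_opG_opX iter_Delta_eq0 ?horner0 ?mulr0 ?scale0r //.
by rewrite (leq_trans (size_polyS_leq R)).
Qed.

Lemma iter_mulfun_shiftV (c : int -> F) (f : int -> {poly F}) j n :
  iter j (mulfun c \o @shiftV F) f n
    = (\prod_(k < j) c (n - k%:Z)) *: f (n - j%:Z).
Proof.
elim: j n => [|j IH] n; first by rewrite big_ord0 scale1r subr0.
rewrite iterS /= /mulfun /shiftV IH scalerA big_ord_recl subr0.
have -> : n - 1 - j%:Z = n - j.+1%:Z by rewrite -addn1 PoszD; ring.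
congr (_ * _ *: _); apply: eq_bigr => k _.
by rewrite /= /bump add1n -[k.+1]addn1 PoszD; congr c; ring.
Qed.

Lemma lowcoefE R n (k : nat) :
  lowcoef R (n%:Z - k%:Z) = (polyS R).[n%:R - k%:R].
Proof. by rewrite /lowcoef horner_polyS mulrC !rmorphB. Qed.

Lemma rec_termE R j n : rec_term R j.+1 n%:Z =
  ((-1) ^+ j.+1 / j.+1`!%:R)
    *: op_exp (opG R) (iter j.+1 (ad (opG R)) opX 'X^n).
Proof.
rewrite /rec_term {1}/mulfun; congr (_ *: _).
rewrite iter_mulfun_shiftV /mulfun scalerA iter_ad_opG_opX.
rewrite (operatorZ (linear_op_exp (linear_opG R) (opG_locally_nilpotent R))).
under eq_bigr do rewrite lowcoefE.
(* For [n < j] the index of [PRz] is negative while the exponent of ['X] truncates to 0; the factor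
   [S(0)] kills both sides. *)
rewrite rmorphB; have [jn|nj] := leqP j n; first by rewrite subzn.
by rewrite (bigD1 (Ordinal nj)) //= subrr polyS0 !mul0r !scale0r.
Qed.

End Monomials.

Theorem theorem4p1 (F : fieldType) (charF : [pchar F] =i pred0)
    (d : nat) (R : {poly F}) (degR : size R = d.+1) :
  (opL R = opH + opG R) /\
  (* (i) *)
  (forall n : nat, opL R (PR R n) = n%:R *: PR R n) /\
  (* (ii) *)
  (forall n : nat,
     'X * PR R n = PR R n.+1 + \sum_(1 <= j < d.+2) rec_term R j n%:Z) /\
  (* (iii) *)
  (forall n : nat,
     opG R (PR R n) = (n%:R * R.[n%:R - 1]) *: PRz R (n%:Z - 1) /\
     opM R (PR R n) = PR R n.+1) /\
  (* (iv) *)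
  (forall n : nat, PR R n = iter n (opM R) 1).
Proof.
have linG := linear_opG R; have nilG := opG_locally_nilpotent R.
have linE := linear_op_exp linG nilG.
have expP0 : PR R 0 = 1.
  rewrite /PR (op_exp_truncate (K := 1)) ?big_ord1 ?invr1 ?scale1r //.
  by move=> j j0; rewrite iter_opG_monomial.
(* [S] has degree at most [d + 1], so its differences of order at least [d + 2] vanish. *)
have adX0 j : (d.+2 <= j)%N -> iter j (ad (opG R)) opX = 0.
  by case: j => // j dj; rewrite iter_ad_opG_opX_eq0 ?degR.
have MP n : opM R (PR R n) = PR R n.+1.
  rewrite /opM /PR -(op_exp_intertwine charF linG nilG linear_opX adX0).
  by rewrite /opX -exprS.
split.
  apply: funext => p; rewrite /opL (sigmaE (@iter_ad_opG_opH _ R)).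
  by rewrite !big_ord_recl big_ord0 /= !invr1 !scale1r addr0 ad_opG_opH.
split=> [n|].
  rewrite /opL /PR.
  have adH0 := @iter_ad_opG_opH _ R.
  rewrite -(op_exp_intertwine charF linG nilG linear_opH adH0).
  by rewrite opH_monomial (operatorZ linE).
split=> [n|].
  rewrite -[LHS]/(opX (PR R n)).
  rewrite (op_exp_intertwine_inv charF linG nilG linear_opX adX0).
  (* The term [i = 0] is [PR R n.+1]; the others form the recurrence sum. *)
  rewrite big_ord_recl expr0 divr1 scale1r /= /opX -exprS; congr (_ + _).
  by rewrite big_add1 big_mkord; apply: eq_bigr => j _; rewrite rec_termE.
split=> [n|]; last by elim=> //= n <-; rewrite MP.
split; last exact: MP.
(* As [G = ad_G(H)], these are the iterates on [H] of order at least 2. *)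
have adG0 j : (1 <= j)%N -> iter j (ad (opG R)) (opG R) = 0.
  by move=> j1; rewrite -{2}(ad_opG_opH R) -iterSr iter_ad_opG_opH.
(* Here [sigma(G) = G], so [G] commutes with [e^G]. *)
rewrite /PR; have := op_exp_intertwine charF linG nilG linG adG0 'X^n.
rewrite (sigmaE adG0) big_ord1 /= invr1 scale1r => <-.
rewrite opG_monomial (operatorZ linE) horner_polyS mulrC.
(* At [n = 0] the sides involve [PR R 0] and [PRz R (-1)], both with coefficient 0. *)
case: n => [|n]; first by rewrite !mul0r !scale0r.
by have -> : n.+1%:Z - 1 = n%:Z by rewrite -addn1 PoszD addrK.
Qed.
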